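(* Let $T$ be a vector space over a field with a trilinear operation $\langle -,-,-\rangle\colon T\times T\times T\to T$. Then $T$ satisfies both identities $$\langle a,\langle b,c,d\rangle,e\rangle-\langle\langle a,b,c\rangle,d,e\rangle+\langle\langle a,c,b\rangle,d,e\rangle+\langle\langle a,d,b\rangle,c,e\rangle-\langle\langle a,d,c\rangle,b,e\rangle\equiv 0,\tag{LTS-A}$$ $$\langle a,b,\langle c,d,e\rangle\rangle-\langle\langle a,b,c\rangle,d,e\rangle+\langle\langle a,b,d\rangle,c,e\rangle-\langle\langle a,b,e\rangle,d,c\rangle+\langle\langle a,b,e\rangle,c,d\rangle\equiv 0\tag{LTS-B}$$ if and only if $T$ satisfies the four identities consisting of (LTS-B) together with $$\langle a,\langle b,c,d\rangle,e\rangle+\langle a,\langle c,b,d\rangle,e\rangle\equiv 0,\tag{LTS1}$$ $$\langle a,\langle b,c,d\rangle,e\rangle+\langle a,\langle c,d,b\rangle,e\rangle+\langle a,\langle d,b,c\rangle,e\rangle\equiv 0,\tag{LTS2}$$ $$\langle\langle c,d,e\rangle,b,a\rangle-\langle\langle c,d,e\rangle,a,b\rangle-\langle\langle c,b,a\rangle,d,e\rangle+\langle\langle c,a,b\rangle,d,e\rangle-\langle c,\langle a,b,d\rangle,e\rangle-\langle c,d,\langle a,b,e\rangle\rangle\equiv 0.\tag{LTS3}$$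
   Context: The symbol $\equiv$ in an identity means that the equation holds for all values of the arguments in $T$. *)

(* Defs.v *)
From mathcomp Require Import all_boot all_order all_algebra.
Set Implicit Arguments.
Unset Strict Implicit.
Unset Printing Implicit Defensive.
Import GRing.Theory.
Local Open Scope ring_scope.

Definition trilinear (F : fieldType) (T : lmodType F) (br : T -> T -> T -> T) : Prop :=
  [/\ forall b c, linear (fun a => br a b c),
      forall a c, linear (fun b => br a b c)
    & forall a b, linear (fun c => br a b c)].

Section Identities.
Variables (T : zmodType) (br : T -> T -> T -> T).
Local Notation "{{ a , b , c }}" := (br a b c)
  (at level 0, a, b, c at level 99, format "{{ a ,  b ,  c }}").

Definition LTS_A : Prop := forall a b c d e : T,
  {{a, {{b, c, d}}, e}} - {{ {{a, b, c}}, d, e}} + {{ {{a, c, b}}, d, e}}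
    + {{ {{a, d, b}}, c, e}} - {{ {{a, d, c}}, b, e}} = 0.

Definition LTS_B : Prop := forall a b c d e : T,
  {{a, b, {{c, d, e}} }} - {{ {{a, b, c}}, d, e}} + {{ {{a, b, d}}, c, e}}
    - {{ {{a, b, e}}, d, c}} + {{ {{a, b, e}}, c, d}} = 0.

Definition LTS1 : Prop := forall a b c d e : T,
  {{a, {{b, c, d}}, e}} + {{a, {{c, b, d}}, e}} = 0.

Definition LTS2 : Prop := forall a b c d e : T,
  {{a, {{b, c, d}}, e}} + {{a, {{c, d, b}}, e}} + {{a, {{d, b, c}}, e}} = 0.

Definition LTS3 : Prop := forall a b c d e : T,
  {{ {{c, d, e}}, b, a}} - {{ {{c, d, e}}, a, b}} - {{ {{c, b, a}}, d, e}}
    + {{ {{c, a, b}}, d, e}} - {{c, {{a, b, d}}, e}} - {{c, d, {{a, b, e}} }} = 0.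

End Identities.

(* Main.v *)
Require Import Defs.
From mathcomp Require Import all_boot all_order all_algebra.

(* Solving (LTS-A) for its first term writes <a,<b,c,d>,e> as an alternating
   sum of <<a,x,y>,z,e> that mirrors the Lie bracket [[b,c],d]; antisymmetry and
   the Jacobi identity are then (LTS1) and (LTS2).  After renaming variables, the
   left-hand sides of (LTS3), (LTS-A) and (LTS-B) sum to 0 formally, so (LTS-A)
   and (LTS3) are equivalent in the presence of (LTS-B). *)

Import GRing.Theory.
Local Open Scope ring_scope.

Section Identities.
Variables (T : zmodType) (br : T -> T -> T -> T).

Lemma LTS_A_solved : LTS_A br -> forall a b c d e,
  br a (br b c d) e =
  (br (br a b c) d e - br (br a c b) d e)
  - (br (br a d b) c e - br (br a d c) b e).
Proof.
move=> A a b c d e; apply/eqP; rewrite -subr_eq0 -(A a b c d e).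
by rewrite !opprB !addrA (ACl (1*5*4*2*3)).
Qed.

Lemma LTS_A_LTS1 : LTS_A br -> LTS1 br.
Proof.
move=> /LTS_A_solved A a b c d e; rewrite !A !opprB !addrA.
(* Swapping [b] and [c] flips all four signs; each pair is a term and its negative. *)
by rewrite (ACl ((1*6)*(2*5)*(3*8)*(4*7))) /= !subrr !addNr !addr0.
Qed.

Lemma LTS_A_LTS2 : LTS_A br -> LTS2 br.
Proof.
move=> /LTS_A_solved A a b c d e; rewrite !A !opprB !addrA.
(* Each of the six orderings of [b], [c], [d] occurs twice, with opposite signs. *)
rewrite (ACl ((1*8)*(2*11)*(3*6)*(4*9)*(5*12)*(7*10))) /=.
by rewrite !subrr !addNr !addr0.
Qed.

(** The summands are [LTS3] at [b c a d e], [LTS_A] at [a b c d e] and [LTS_B] at [a d b c e]; their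
    16 terms cancel in pairs. *)
Lemma LTS_A_B_3_sum a b c d e :
  br (br a d e) c b - br (br a d e) b c - br (br a c b) d e
    + br (br a b c) d e - br a (br b c d) e - br a d (br b c e)
  + (br a (br b c d) e - br (br a b c) d e + br (br a c b) d e
    + br (br a d b) c e - br (br a d c) b e)
  + (br a d (br b c e) - br (br a d b) c e + br (br a d c) b e
    - br (br a d e) c b + br (br a d e) b c) = 0.
Proof.
rewrite !addrA.
rewrite (ACl ((1*15)*(2*16)*(3*9)*(4*8)*(5*7)*(6*12)*(10*13)*(11*14))) /=.
by rewrite !subrr !addNr !addr0.
Qed.

Lemma LTS_B_A_iff_LTS3 : LTS_B br -> LTS_A br <-> LTS3 br.
Proof.
(* The order [b c a d e] makes the [LTS3] goal the first summand. *)
move=> B; split=> [A b c a d e | L3 a b c d e];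
  have := LTS_A_B_3_sum a b c d e; rewrite B addr0.
- by rewrite A addr0.
- by rewrite L3 add0r.
Qed.

End Identities.

Theorem lemma8 (F : fieldType) (T : lmodType F) (br : T -> T -> T -> T)
    (br_trilinear : trilinear br) :
  (LTS_A br /\ LTS_B br) <->
  [/\ LTS_B br, LTS1 br, LTS2 br & LTS3 br].
Proof.
split=> [[A B] | [B _ _ L3]].
- split=> //; [exact: LTS_A_LTS1 | exact: LTS_A_LTS2 |].
  exact/(LTS_B_A_iff_LTS3 _ _ B).
- by split=> //; apply/(LTS_B_A_iff_LTS3 _ _ B).
Qed.
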